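(* Let $\mathcal{C}$ be the category whose objects are the abstract algebras $A$ (non-empty sets) with two (not necessarily different) constants $0$ and $1$, a binary map $\oplus$, a unary map $\ominus$, a unary map $m_\lambda$ for every $\lambda\in\mathbb{R}$, a binary map $\odot$, and binary maps $\sqcap$ and $\sqcup$, in which the following identities are satisfied for all $x,y,z\in A$ and all $\lambda,\mu\in\mathbb{R}$ (in (19): all $\lambda\in\mathbb{R}_{\geq 0}$): (1) $(x\oplus y)\oplus z=x\oplus(y\oplus z)$; (2) $x\oplus 0=x$; (3) $x\oplus(\ominus x)=0$; (4) $x\oplus y=y\oplus x$; (5) $m_\lambda(x\oplus y)=m_\lambda(x)\oplus m_\lambda(y)$; (6) $m_{\lambda+\mu}(x)=m_\lambda(x)\oplus m_\mu(x)$; (7) $m_{\lambda\mu}(x)=m_\lambda(m_\mu(x))$; (8) $m_1(x)=x$; (9) $(x\odot y)\odot z=x\odot(y\odot z)$; (10) $x\odot(y\oplus z)=(x\odot y)\oplus(x\odot z)$; (11) $(x\oplus y)\odot z=(x\odot z)\oplus(y\odot z)$; (12) $m_\lambda(x\odot y)=m_\lambda(x)\odot y=x\odot m_\lambda(y)$; (13) $1\odot x=x\odot 1=x$; (14) $x\sqcap(y\sqcap z)=(x\sqcap y)\sqcap z$ and $x\sqcup(y\sqcup z)=(x\sqcup y)\sqcup z$; (15) $x\sqcap x=x$ and $x\sqcup x=x$; (16) $x\sqcap y=y\sqcap x$ and $x\sqcup y=y\sqcup x$; (17) $x\sqcap(x\sqcup y)=x$ and $x\sqcup(x\sqcap y)=x$;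 (18) $x\oplus(y\sqcap z)=(x\oplus y)\sqcap(x\oplus z)$; (19) $m_\lambda(0\sqcap x)=0\sqcap(m_\lambda(x))$; (20) $0\sqcap\big((x\sqcap(\ominus x))\odot(y\sqcap(\ominus y))\big)=0$; and whose morphisms are the abstract algebra homomorphisms. Then the category of unital vector lattice algebras, with the unital vector lattice algebra homomorphisms as morphisms, is isomorphic to $\mathcal{C}$, by an isomorphism that keeps the underlying sets of objects and the maps that are the morphisms.
   Context: A vector lattice algebra is a real vector lattice that is also an associative algebra such that the product of two positive elements is positive; it is unital if it has an identity element $1$ for the multiplication, which need not be positive (and $1=0$ is not excluded). A unital vector lattice algebra homomorphism is a linear map that is a lattice homomorphism, is multiplicative, and preserves the identity element. An abstract algebra homomorphism between two abstract algebras with constants and maps as listed is a map $h$ between the underlying sets that sends the constants $0$ and $1$ of the domain to the corresponding constants of the codomain and commutes with all the maps $\oplus$, $\ominus$, $m_\lambda$ ($\lambda\in\mathbb{R}$), $\odot$, $\sqcap$, $\sqcup$. *)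

(* Defs.v *)
From Stdlib Require Import Reals Relations ProofIrrelevance.
From Coquelicot Require Import Coquelicot.

Set Implicit Arguments.
Unset Strict Implicit.
Unset Printing Implicit Defensive.

Record Category : Type := MkCategory {
  ob : Type;
  hom : ob -> ob -> Type;
  idm : forall X, hom X X;
  compm : forall X Y Z, hom Y Z -> hom X Y -> hom X Z;
  compm_idl : forall X Y (f : hom X Y), compm (idm Y) f = f;
  compm_idr : forall X Y (f : hom X Y), compm f (idm X) = f;
  compm_assoc : forall X Y Z T (f : hom Z T) (g : hom Y Z) (h : hom X Y),
    compm f (compm g h) = compm (compm f g) h }.

Arguments hom {c} X Y.
Arguments idm {c} X.
Arguments compm {c X Y Z} f g.

Record Functor (C D : Category) : Type := MkFunctor {
  fob : ob C -> ob D;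
  fmap : forall X Y : ob C, hom X Y -> hom (fob X) (fob Y);
  fmap_id : forall X : ob C, fmap (idm X) = idm (fob X);
  fmap_comp : forall (X Y Z : ob C) (f : hom Y Z) (g : hom X Y),
    fmap (compm f g) = compm (fmap f) (fmap g) }.

Definition functor_id (C : Category) : Functor C C :=
  @MkFunctor C C (fun X => X) (fun X Y f => f)
    (fun X => eq_refl) (fun X Y Z f g => eq_refl).

Definition functor_comp (C D E : Category) (G : Functor D E) (F : Functor C D) :
  Functor C E.
Proof.
  refine (@MkFunctor C E (fun X => fob G (fob F X))
            (fun X Y f => fmap G (fmap F f)) _ _).
  - intros X; rewrite (fmap_id F); apply fmap_id.
  - intros X Y Z f g; rewrite (fmap_comp F); apply fmap_comp.
Defined.

Definition is_isomorphism (C D : Category) (F : Functor C D) : Prop :=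
  exists G : Functor D C,
    functor_comp G F = functor_id C /\ functor_comp F G = functor_id D.

Definition TypeCat : Category :=
  @MkCategory Type (fun X Y => X -> Y) (fun X x => x)
    (fun X Y Z f g x => f (g x))
    (fun X Y f => eq_refl) (fun X Y f => eq_refl)
    (fun X Y Z T f g h => eq_refl).

Definition concrete_category (O : Type) (car : O -> Type)
    (P : forall A B : O, (car A -> car B) -> Prop)
    (P_id : forall A, P A A (fun x => x))
    (P_comp : forall A B C (f : car B -> car C) (g : car A -> car B),
        P B C f -> P A B g -> P A C (fun x => f (g x))) : Category.
Proof.
  refine (@MkCategory O (fun A B => {h : car A -> car B | P A B h})
    (fun A => exist _ (fun x => x) (P_id A))
    (fun A B C f g =>
       exist _ (fun x => proj1_sig f (proj1_sig g x))
         (P_comp A B C _ _ (proj2_sig f) (proj2_sig g))) _ _ _).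
  - intros A B [f pf]; apply subset_eq_compat; reflexivity.
  - intros A B [f pf]; apply subset_eq_compat; reflexivity.
  - intros A B C D [f pf] [g pg] [h ph]; apply subset_eq_compat; reflexivity.
Defined.

Definition concrete_forget (O : Type) (car : O -> Type)
    (P : forall A B : O, (car A -> car B) -> Prop) P_id P_comp :
  Functor (@concrete_category O car P P_id P_comp) TypeCat :=
  @MkFunctor (@concrete_category O car P P_id P_comp) TypeCat car
    (fun A B f => proj1_sig f)
    (fun A => eq_refl) (fun A B C f g => eq_refl).

Section Lattice.
Context {T : Type} (le : relation T).

Definition is_inf (x y z : T) : Prop :=
  le z x /\ le z y /\ forall w, le w x -> le w y -> le w z.

Definition is_sup (x y z : T) : Prop :=
  le x z /\ le y z /\ forall w, le x w -> le y w -> le z w.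

End Lattice.

Record is_vector_lattice (V : ModuleSpace R_Ring) (le : relation V) : Prop := {
  vl_order : order V le;
  vl_le_plus : forall x y z : V, le x y -> le (plus x z) (plus y z);
  vl_le_scal : forall (a : R) (x : V), (0 <= a)%R -> le zero x -> le zero (scal a x);
  vl_inf : forall x y : V, exists z, is_inf le x y z;
  vl_sup : forall x y : V, exists z, is_sup le x y z }.

(** The associativity and distributivity of the product and the laws of the
    identity element are part of [Ring.mixin_of]; Coquelicot's rings do not
    require the identity to be nonzero. *)
Record is_unital_vector_lattice_algebra (V : ModuleSpace R_Ring)
    (r : Ring.mixin_of V) (le : relation V) : Prop := {
  uvla_lattice : is_vector_lattice le;
  uvla_scal_mult_l : forall (a : R) (x y : V),
    scal a (Ring.mult _ r x y) = Ring.mult _ r (scal a x) y;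
  uvla_scal_mult_r : forall (a : R) (x y : V),
    scal a (Ring.mult _ r x y) = Ring.mult _ r x (scal a y);
  uvla_le_mult : forall x y : V,
    le zero x -> le zero y -> le zero (Ring.mult _ r x y) }.

(** The structure is stored as [ModuleSpace.class_of] on a carrier rather than
    as a [ModuleSpace], because the packed records of Coquelicot contain an
    extra irrelevant field of type [Type], so that distinct packed modules can
    carry the same vector space structure. *)
Record UVLA : Type := MkUVLA {
  uvla_sort : Type;
  uvla_class : ModuleSpace.class_of R_Ring uvla_sort;
  uvla_ring : Ring.mixin_of (ModuleSpace.Pack R_Ring uvla_sort uvla_class uvla_sort);
  uvla_le : relation uvla_sort;
  uvla_axioms : @is_unital_vector_lattice_algebra
    (ModuleSpace.Pack R_Ring uvla_sort uvla_class uvla_sort) uvla_ring uvla_le }.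

Definition uvla_module (A : UVLA) : ModuleSpace R_Ring :=
  ModuleSpace.Pack R_Ring (uvla_sort A) (uvla_class A) (uvla_sort A).

Definition uvla_mult (A : UVLA) : uvla_module A -> uvla_module A -> uvla_module A :=
  Ring.mult _ (uvla_ring A).

Definition uvla_one (A : UVLA) : uvla_module A := Ring.one _ (uvla_ring A).

Record is_uvla_hom (A B : UVLA) (h : uvla_module A -> uvla_module B) : Prop := {
  uvla_hom_plus : forall x y, h (plus x y) = plus (h x) (h y);
  uvla_hom_scal : forall (a : R) x, h (scal a x) = scal a (h x);
  uvla_hom_inf : forall x y z,
    is_inf (@uvla_le A) x y z -> is_inf (@uvla_le B) (h x) (h y) (h z);
  uvla_hom_sup : forall x y z,
    is_sup (@uvla_le A) x y z -> is_sup (@uvla_le B) (h x) (h y) (h z);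
  uvla_hom_mult : forall x y, h (uvla_mult x y) = uvla_mult (h x) (h y);
  uvla_hom_one : h (uvla_one A) = uvla_one B }.

Lemma is_uvla_hom_id (A : UVLA) : @is_uvla_hom A A (fun x => x).
Proof. split; auto. Qed.

Lemma is_uvla_hom_comp (A B C : UVLA) (f : uvla_sort B -> uvla_sort C)
    (g : uvla_sort A -> uvla_sort B) :
  @is_uvla_hom B C f -> @is_uvla_hom A B g -> @is_uvla_hom A C (fun x => f (g x)).
Proof.
  intros [f1 f2 f3 f4 f5 f6] [g1 g2 g3 g4 g5 g6]; split.
  - intros x y; rewrite g1; apply f1.
  - intros a x; rewrite g2; apply f2.
  - intros x y z H; apply f3, g3, H.
  - intros x y z H; apply f4, g4, H.
  - intros x y; rewrite g5; apply f5.
  - rewrite g6; apply f6.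
Qed.

Definition UVLA_cat : Category := concrete_category is_uvla_hom_id is_uvla_hom_comp.

Definition UVLA_forget : Functor UVLA_cat TypeCat :=
  concrete_forget is_uvla_hom_id is_uvla_hom_comp.

(** Constants exist, so the carrier is automatically non-empty. *)
Record AlgSig : Type := MkAlgSig {
  as_sort :> Type;
  as_zero : as_sort;
  as_one : as_sort;
  as_add : as_sort -> as_sort -> as_sort;
  as_opp : as_sort -> as_sort;
  as_scal : R -> as_sort -> as_sort;
  as_mul : as_sort -> as_sort -> as_sort;
  as_meet : as_sort -> as_sort -> as_sort;
  as_join : as_sort -> as_sort -> as_sort }.

Arguments as_zero {a}.
Arguments as_one {a}.
Arguments as_scal {a} l x.

Declare Scope alg_scope.
Delimit Scope alg_scope with alg.
Notation "𝟎" := as_zero (at level 0) : alg_scope.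
Notation "𝟏" := as_one (at level 0) : alg_scope.
Notation "x ⊕ y" := (as_add x y) (at level 50, left associativity) : alg_scope.
Notation "⊖ x" := (as_opp x) (at level 35, right associativity) : alg_scope.
Notation "x ⊙ y" := (as_mul x y) (at level 40, left associativity) : alg_scope.
Notation "x ⊓ y" := (as_meet x y) (at level 45, left associativity) : alg_scope.
Notation "x ⊔ y" := (as_join x y) (at level 45, left associativity) : alg_scope.
Notation "'m[' l ] x" := (as_scal l x)
  (at level 35, l at level 200, right associativity) : alg_scope.

Local Open Scope alg_scope.

Record satisfies_identities (A : AlgSig) : Prop := {
  add_assoc : forall x y z : A, (x ⊕ y) ⊕ z = x ⊕ (y ⊕ z);
  add_zero : forall x : A, x ⊕ 𝟎 = x;
  add_opp : forall x : A, x ⊕ (⊖ x) = 𝟎;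
  add_comm : forall x y : A, x ⊕ y = y ⊕ x;
  scal_add : forall (l : R) (x y : A), m[l] (x ⊕ y) = (m[l] x) ⊕ (m[l] y);
  scal_Rplus : forall (l u : R) (x : A), m[(l + u)%R] x = (m[l] x) ⊕ (m[u] x);
  scal_Rmult : forall (l u : R) (x : A), m[(l * u)%R] x = m[l] (m[u] x);
  scal_R1 : forall x : A, m[1%R] x = x;
  mul_assoc : forall x y z : A, (x ⊙ y) ⊙ z = x ⊙ (y ⊙ z);
  mul_add_r : forall x y z : A, x ⊙ (y ⊕ z) = (x ⊙ y) ⊕ (x ⊙ z);
  mul_add_l : forall x y z : A, (x ⊕ y) ⊙ z = (x ⊙ z) ⊕ (y ⊙ z);
  scal_mul : forall (l : R) (x y : A),
    m[l] (x ⊙ y) = (m[l] x) ⊙ y /\ (m[l] x) ⊙ y = x ⊙ (m[l] y);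
  mul_one : forall x : A, 𝟏 ⊙ x = x ⊙ 𝟏 /\ x ⊙ 𝟏 = x;
  meet_join_assoc : forall x y z : A,
    x ⊓ (y ⊓ z) = (x ⊓ y) ⊓ z /\ x ⊔ (y ⊔ z) = (x ⊔ y) ⊔ z;
  meet_join_idem : forall x : A, x ⊓ x = x /\ x ⊔ x = x;
  meet_join_comm : forall x y : A, x ⊓ y = y ⊓ x /\ x ⊔ y = y ⊔ x;
  meet_join_absorb : forall x y : A, x ⊓ (x ⊔ y) = x /\ x ⊔ (x ⊓ y) = x;
  add_meet : forall x y z : A, x ⊕ (y ⊓ z) = (x ⊕ y) ⊓ (x ⊕ z);
  scal_meet : forall (l : R) (x : A), (0 <= l)%R -> m[l] (𝟎 ⊓ x) = 𝟎 ⊓ (m[l] x);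
  mul_pos : forall x y : A, 𝟎 ⊓ ((x ⊓ (⊖ x)) ⊙ (y ⊓ (⊖ y))) = 𝟎 }.

Record AbsAlg : Type := MkAbsAlg {
  aa_sig :> AlgSig;
  aa_identities : satisfies_identities aa_sig }.

Record is_alg_hom (A B : AlgSig) (h : A -> B) : Prop := {
  alg_hom_zero : h 𝟎 = 𝟎;
  alg_hom_one : h 𝟏 = 𝟏;
  alg_hom_add : forall x y, h (x ⊕ y) = h x ⊕ h y;
  alg_hom_opp : forall x, h (⊖ x) = ⊖ h x;
  alg_hom_scal : forall (l : R) x, h (m[l] x) = m[l] h x;
  alg_hom_mul : forall x y, h (x ⊙ y) = h x ⊙ h y;
  alg_hom_meet : forall x y, h (x ⊓ y) = h x ⊓ h y;
  alg_hom_join : forall x y, h (x ⊔ y) = h x ⊔ h y }.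

Lemma is_alg_hom_id (A : AbsAlg) : @is_alg_hom A A (fun x => x).
Proof. split; auto. Qed.

Lemma is_alg_hom_comp (A B C : AbsAlg) (f : B -> C) (g : A -> B) :
  is_alg_hom f -> is_alg_hom g -> is_alg_hom (fun x => f (g x)).
Proof.
  intros [f1 f2 f3 f4 f5 f6 f7 f8] [g1 g2 g3 g4 g5 g6 g7 g8];
    split; intros; congruence.
Qed.

Definition AbsAlg_cat : Category := concrete_category is_alg_hom_id is_alg_hom_comp.

Definition AbsAlg_forget : Functor AbsAlg_cat TypeCat :=
  concrete_forget is_alg_hom_id is_alg_hom_comp.

(* Main.v *)
Require Import Defs.
From Stdlib Require Import Reals Lra Relations ProofIrrelevance Eqdep.
From Stdlib Require Import FunctionalExtensionality PropExtensionality IndefiniteDescription.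
From Coquelicot Require Import Coquelicot.
Set Bullet Behavior "Strict Subproofs".

(** A vector lattice determines the two maps [⊓] and [⊔], because infima and
    suprema are unique, and conversely [⊓] determines the order, by
    [x ≤ y] iff [x ⊓ y = x]. Passing between the two presentations therefore
    changes neither the underlying set nor the linear and multiplicative
    operations, and it is clear that the passages are mutually inverse once both
    are known to be well defined.

    Most of the identities are literally the axioms of modules, of rings and of
    the two operations of an order lattice. The other three translate the
    compatibility of the order with the algebra. The identity [add_meet] says
    that translations preserve infima, which is equivalent to their monotonicity
    because they are invertible ([is_inf_plus]). The identity [scal_meet] says
    that scaling by [λ ≥ 0] preserves infima with zero: for [λ > 0] it has the
    inverse scaling by [1/λ], and for [λ = 0] both sides vanish ([is_inf_scal]).
    The identity [mul_pos] is positivity of the product. Indeed, the elements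
    [x ⊓ ⊖x] are exactly those below zero: twice such an element is at most
    [x - x = 0] ([is_inf_opp_le_zero]), and for [x ≥ 0] it equals [⊖x]. Since
    [(-x)(-y) = xy] ([bilinear_opp_opp]), products of two elements below zero are
    positive iff products of two positive elements are.

    A linear map that preserves infima and suprema as relations commutes with
    the chosen operations, and conversely, again by uniqueness; hence the
    morphisms are the same maps.

    Finally, the equality of functors needs care, since the composite of the two
    object maps is only propositionally the identity. Both categories consist of
    structured sets with certain maps, and a functor into such a category is
    determined by its object map and its composite with the forgetful functor
    ([concrete_functor_eq]). All the constructions commute with the forgetful
    functors strictly, so it remains to prove that the objects are equal
    ([uvla_of_alg_of_uvla], [alg_of_uvla_of_alg]). *)

(** * Equality of functors into a concrete category *)

Lemma functor_eq (C D : Category) (o : ob C -> ob D)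
    (m : forall X Y : ob C, hom X Y -> hom (o X) (o Y)) p q p' q' :
  @MkFunctor C D o m p q = @MkFunctor C D o m p' q'.
Proof. f_equal; apply proof_irrelevance. Qed.

(** Comparing the functors after forgetting avoids transporting morphisms along
    the equalities of objects: the second hypothesis relates maps whose types are
    equal on the nose in the applications. *)
Lemma concrete_functor_eq (C : Category) (O : Type) (car : O -> Type)
    (P : forall A B : O, (car A -> car B) -> Prop) P_id P_comp
    (F G : Functor C (@concrete_category O car P P_id P_comp)) :
  (forall X, fob F X = fob G X) ->
  functor_comp (concrete_forget P_id P_comp) F =
    functor_comp (concrete_forget P_id P_comp) G ->
  F = G.
Proof.
  destruct F as [o m p q], G as [o' m' p' q']; simpl; intros Hob Hforget.
  assert (o = o') by (apply functional_extensionality; exact Hob); subst o'.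
  (* The maps on morphisms have a type that depends on the object map, so that
     injectivity of the constructor only gives equality of dependent pairs. *)
  injection Hforget as Hm.
  apply inj_pair2 in Hm.
  assert (m = m') as <-.
  { apply functional_extensionality_dep; intros X.
    apply functional_extensionality_dep; intros Y.
    apply functional_extensionality; intros f.
    pose proof (f_equal (fun k => k X Y f) Hm) as Hf; cbn beta in Hf.
    apply eq_sig_hprop; [intros; apply proof_irrelevance | exact Hf]. }
  apply functor_eq.
Qed.

(** * Order lattices *)

Section OrderLattice.
Variables (T : Type) (le : relation T).
Hypothesis le_order : order T le.

(** Suprema are infima for the converse order, definitionally; this makes the
    lemmas on infima apply to suprema. *)
Lemma order_converse : order T (fun x y => le y x).
Proof.
  destruct le_order as [Hr Ht Ha]; split.
  - exact Hr.
  - intros x y z Hxy Hyz; exact (Ht _ _ _ Hyz Hxy).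
  - intros x y Hxy Hyx; exact (Ha _ _ Hyx Hxy).
Qed.

Lemma is_inf_unique x y z z' : is_inf le x y z -> is_inf le x y z' -> z = z'.
Proof.
  intros (Hx & Hy & Hg) (Hx' & Hy' & Hg').
  apply (ord_antisym _ _ le_order); auto.
Qed.

Lemma is_inf_le x y : le x y -> is_inf le x y x.
Proof. intros Hxy; split; [apply (ord_refl _ _ le_order) | split; auto]. Qed.

Variable meet : T -> T -> T.
Hypothesis is_inf_meet : forall x y, is_inf le x y (meet x y).

Lemma le_meetP x y : le x y <-> meet x y = x.
Proof.
  split.
  - intros Hxy; apply (is_inf_unique x y); auto using is_inf_le.
  - intros <-; apply is_inf_meet.
Qed.

Lemma inf_idem x : meet x x = x.
Proof. apply le_meetP, (ord_refl _ _ le_order). Qed.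

Lemma inf_comm x y : meet x y = meet y x.
Proof.
  apply (is_inf_unique x y); auto.
  destruct (is_inf_meet y x) as (Hy & Hx & Hg); split; auto.
Qed.

Lemma inf_assoc x y z : meet x (meet y z) = meet (meet x y) z.
Proof.
  pose proof (ord_trans _ _ le_order) as Ht.
  apply (is_inf_unique x (meet y z)); auto.
  destruct (is_inf_meet x y) as (Hx & Hy & Hg).
  destruct (is_inf_meet y z) as (Hy' & Hz' & Hg').
  destruct (is_inf_meet (meet x y) z) as (Hxy & Hz & Hg'').
  split; [exact (Ht _ _ _ Hxy Hx) | split].
  - apply Hg'; [exact (Ht _ _ _ Hxy Hy) | exact Hz].
  - intros w Hwx Hwyz; apply Hg''; [apply Hg |]; eauto.
Qed.

End OrderLattice.

(** * Vector lattices *)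

(** This is [plus_opp_r] for the monoid projected directly from the module. A
    sum of vectors elaborates to that form, whereas [plus_opp_r] speaks of the
    convertible monoid projected from the group of the module, which [rewrite]
    does not identify with it. *)
Lemma module_plus_opp_r (V : ModuleSpace R_Ring) (x : V) : plus x (opp x) = zero.
Proof. exact (plus_opp_r x). Qed.

Lemma module_plus_opp_l (V : ModuleSpace R_Ring) (x : V) : plus (opp x : V) x = zero.
Proof. exact (plus_opp_l x). Qed.

Section VectorLattice.
Variables (V : ModuleSpace R_Ring) (le : relation V).
Hypothesis HV : is_vector_lattice le.

Lemma vl_le_plus_l x y z : le x y -> le (plus z x) (plus z y).
Proof.
  intros Hxy; rewrite (plus_comm z x), (plus_comm z y); apply (vl_le_plus HV), Hxy.
Qed.

Lemma vl_le_scal_mono a x y : (0 <= a)%R -> le x y -> le (scal a x) (scal a y).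
Proof.
  intros Ha Hxy.
  assert (H0 : le zero (plus y (opp x))).
  { pose proof (vl_le_plus HV (opp x) Hxy) as H0.
    rewrite module_plus_opp_r in H0; exact H0. }
  apply (vl_le_scal HV Ha) in H0.
  apply (fun H => vl_le_plus HV (scal a x) H) in H0.
  rewrite plus_zero_l, <- scal_distr_l, <- plus_assoc, module_plus_opp_l, plus_zero_r in H0.
  exact H0.
Qed.

(** Translation by [x] is monotone with monotone inverse, hence an order
    automorphism. *)
Lemma is_inf_plus x y z w :
  is_inf le y z w -> is_inf le (plus x y) (plus x z) (plus x w).
Proof.
  intros (Hy & Hz & Hg); split; [| split]; auto using vl_le_plus_l.
  intros v Hvy Hvz.
  apply (vl_le_plus_l _ _ (opp x)) in Hvy; apply (vl_le_plus_l _ _ (opp x)) in Hvz.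
  rewrite plus_assoc, module_plus_opp_l, plus_zero_l in Hvy, Hvz.
  pose proof (vl_le_plus_l _ _ x (Hg _ Hvy Hvz)) as Hv.
  rewrite plus_assoc, module_plus_opp_r, plus_zero_l in Hv; exact Hv.
Qed.

(** For [a > 0] scaling is an order automorphism with inverse scaling by [1/a];
    for [a = 0] everything collapses to zero. *)
Lemma is_inf_scal a x y w :
  (0 <= a)%R -> is_inf le x y w -> is_inf le (scal a x) (scal a y) (scal a w).
Proof.
  intros [Ha | <-] (Hx & Hy & Hg).
  - split; [| split]; try (apply vl_le_scal_mono; auto; lra).
    intros v Hvx Hvy.
    assert (Hia : (0 <= / a)%R) by (left; apply Rinv_0_lt_compat, Ha).
    assert (Hcancel : forall u b c, Rmult b c = 1%R -> scal b (scal c u) = (u : V)).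
    { intros u b c Hbc; rewrite scal_assoc.
      change (mult b c) with (Rmult b c); rewrite Hbc; apply (scal_one u). }
    apply (vl_le_scal_mono _ _ _ Hia) in Hvx; apply (vl_le_scal_mono _ _ _ Hia) in Hvy.
    rewrite Hcancel in Hvx, Hvy by (field; lra).
    rewrite <- (Hcancel v a (/ a)%R) by (field; lra).
    apply vl_le_scal_mono; auto; lra.
  - rewrite !(scal_zero_l (K := R_Ring) : forall u : V, scal 0%R u = zero).
    apply is_inf_le; [apply (vl_order HV) |]; apply (ord_refl _ _ (vl_order HV)).
Qed.

(** Adding [w <= x] and [w <= - x] gives [2 w <= 0], which is then halved. *)
Lemma is_inf_opp_le_zero x w : is_inf le x (opp x) w -> le w zero.
Proof.
  intros (Hx & Hox & _).
  assert (Hww : le (plus w w) zero).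
  { apply (ord_trans _ _ (vl_order HV)) with (plus x w).
    - apply (vl_le_plus HV), Hx.
    - pose proof (vl_le_plus_l _ _ x Hox) as H0.
      rewrite module_plus_opp_r in H0; exact H0. }
  apply (vl_le_scal_mono (/ 2)%R) in Hww; [| lra].
  rewrite scal_zero_r, scal_distr_l, <- scal_distr_r in Hww.
  change (plus (/ 2)%R (/ 2)%R) with (Rplus (/ 2) (/ 2)) in Hww.
  replace (Rplus (/ 2) (/ 2)) with (@one R_Ring) in Hww by (unfold one; simpl; field).
  rewrite scal_one in Hww; exact Hww.
Qed.

Lemma vl_opp_le_zero x : le zero x -> le (opp x) zero.
Proof.
  intros Hx; apply (fun H => vl_le_plus HV (opp x) H) in Hx.
  rewrite plus_zero_l, module_plus_opp_r in Hx; exact Hx.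
Qed.

Lemma vl_zero_le_opp x : le x zero -> le zero (opp x).
Proof.
  intros Hx; apply (fun H => vl_le_plus HV (opp x) H) in Hx.
  rewrite plus_zero_l, module_plus_opp_r in Hx; exact Hx.
Qed.

End VectorLattice.

Lemma bilinear_opp_opp (V : ModuleSpace R_Ring) (b : V -> V -> V) :
  (forall a x y, scal a (b x y) = b (scal a x) y) ->
  (forall a x y, scal a (b x y) = b x (scal a y)) ->
  forall x y, b (opp x) (opp y) = b x y.
Proof.
  intros Hl Hr x y.
  rewrite <- !scal_opp_one, <- Hl, <- Hr, !scal_opp_one; exact (opp_opp (b x y)).
Qed.

(** * From vector lattice algebras to abstract algebras *)

Definition uvla_inf (A : UVLA) (x y : uvla_module A) : uvla_module A :=
  proj1_sig (constructive_indefinite_description _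
    (vl_inf (uvla_lattice (uvla_axioms A)) x y)).

Definition uvla_sup (A : UVLA) (x y : uvla_module A) : uvla_module A :=
  proj1_sig (constructive_indefinite_description _
    (vl_sup (uvla_lattice (uvla_axioms A)) x y)).

Lemma uvla_inf_spec (A : UVLA) x y : is_inf (@uvla_le A) x y (uvla_inf A x y).
Proof. unfold uvla_inf; apply proj2_sig. Qed.

Lemma uvla_sup_spec (A : UVLA) x y : is_sup (@uvla_le A) x y (uvla_sup A x y).
Proof. unfold uvla_sup; apply proj2_sig. Qed.

Lemma uvla_order (A : UVLA) : order _ (@uvla_le A).
Proof. exact (vl_order (uvla_lattice (uvla_axioms A))). Qed.

Lemma uvla_inf_eq (A : UVLA) x y z :
  is_inf (@uvla_le A) x y z -> uvla_inf A x y = z.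
Proof.
  intros Hz; exact (is_inf_unique _ _ (uvla_order A) _ _ _ _ (uvla_inf_spec A x y) Hz).
Qed.

Lemma uvla_sup_eq (A : UVLA) x y z :
  is_sup (@uvla_le A) x y z -> uvla_sup A x y = z.
Proof.
  intros Hz.
  exact (is_inf_unique _ _ (order_converse _ _ (uvla_order A)) _ _ _ _
    (uvla_sup_spec A x y) Hz).
Qed.

Definition alg_sig_of_uvla (A : UVLA) : AlgSig :=
  @MkAlgSig (uvla_module A) zero (uvla_one A) plus opp scal (@uvla_mult A)
    (uvla_inf A) (uvla_sup A).

(** Only [add_meet], [scal_meet] and [mul_pos] go beyond the axioms of modules,
    rings and order lattices. *)
Lemma alg_sig_of_uvla_identities (A : UVLA) :
  satisfies_identities (alg_sig_of_uvla A).
Proof.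
  pose proof (uvla_axioms A) as HA.
  pose proof (uvla_lattice HA) as HV.
  pose proof (uvla_order A) as Ho.
  pose proof (order_converse _ _ Ho) as Hoc.
  pose proof (uvla_inf_spec A) as Hinf.
  pose proof (uvla_sup_spec A) as Hsup.
  split; simpl.
  - intros x y z; symmetry; apply (plus_assoc (G := uvla_module A)).
  - intros x; apply (plus_zero_r (G := uvla_module A)).
  - intros x; apply (plus_opp_r (G := uvla_module A)).
  - intros x y; apply (plus_comm (G := uvla_module A)).
  - intros l x y; apply (scal_distr_l (V := uvla_module A)).
  - intros l u x; apply (scal_distr_r (V := uvla_module A)).
  - intros l u x; symmetry; apply (scal_assoc (V := uvla_module A)).
  - intros x; apply (scal_one (V := uvla_module A)).
  - intros x y z; symmetry; apply (Ring.ax1 _ (uvla_ring A)).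
  - intros x y z; apply (Ring.ax5 _ (uvla_ring A)).
  - intros x y z; apply (Ring.ax4 _ (uvla_ring A)).
  - intros l x y; split; [apply (uvla_scal_mult_l HA) |].
    etransitivity; [symmetry; apply (uvla_scal_mult_l HA) | apply (uvla_scal_mult_r HA)].
  - intros x; split; [| apply (Ring.ax2 _ (uvla_ring A))].
    transitivity x; [| symmetry]; [apply (Ring.ax3 _ (uvla_ring A)) |].
    apply (Ring.ax2 _ (uvla_ring A)).
  - intros x y z; split; [apply (inf_assoc _ _ Ho _ Hinf) | apply (inf_assoc _ _ Hoc _ Hsup)].
  - intros x; split; [apply (inf_idem _ _ Ho _ Hinf) | apply (inf_idem _ _ Hoc _ Hsup)].
  - intros x y; split; [apply (inf_comm _ _ Ho _ Hinf) | apply (inf_comm _ _ Hoc _ Hsup)].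
  - intros x y; split.
    + apply (le_meetP _ _ Ho _ Hinf), Hsup.
    + apply (le_meetP _ _ Hoc _ Hsup), Hinf.
  - intros x y z; symmetry; apply uvla_inf_eq, (is_inf_plus _ _ HV), Hinf.
  - intros l x Hl; symmetry; apply uvla_inf_eq.
    pose proof (is_inf_scal (uvla_module A) _ HV l zero x _ Hl (Hinf (@zero (uvla_module A)) x)) as H.
    rewrite scal_zero_r in H; exact H.
  - intros x y; apply (le_meetP _ _ Ho _ Hinf).
    (* Both factors are at most zero; pass to their opposites. *)
    rewrite <- (bilinear_opp_opp (uvla_module A) (@uvla_mult A)
      (uvla_scal_mult_l HA) (uvla_scal_mult_r HA)).
    apply (uvla_le_mult HA); apply (vl_zero_le_opp _ _ HV);
      eapply (is_inf_opp_le_zero _ _ HV); apply Hinf.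
Qed.

Definition alg_of_uvla (A : UVLA) : AbsAlg :=
  MkAbsAlg (alg_sig_of_uvla_identities A).

(** * From abstract algebras to vector lattice algebras *)

Local Open Scope alg_scope.

Definition alg_le (A : AlgSig) : relation A := fun x y => x ⊓ y = x.

Section AbstractAlgebra.
Variables (A : AlgSig) (HA : satisfies_identities A).

Lemma alg_le_order : order A (alg_le A).
Proof.
  unfold alg_le; split.
  - intros x; apply (meet_join_idem HA).
  - intros x y z Hxy Hyz.
    rewrite <- Hxy, <- (proj1 (meet_join_assoc HA x y z)), Hyz; reflexivity.
  - intros x y Hxy Hyx; rewrite <- Hxy, (proj1 (meet_join_comm HA x y)); exact Hyx.
Qed.

(** The absorption laws make the orders defined by [⊓] and by [⊔] coincide, so
    that [⊔] is a supremum for the order defined by [⊓]. *)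
Lemma alg_le_join x y : alg_le A x y <-> x ⊔ y = y.
Proof.
  unfold alg_le; split.
  - intros <-; rewrite (proj2 (meet_join_comm HA _ _)), (proj1 (meet_join_comm HA x y)).
    apply (meet_join_absorb HA).
  - intros <-; apply (meet_join_absorb HA).
Qed.

Lemma alg_is_inf x y : is_inf (alg_le A) x y (x ⊓ y).
Proof.
  unfold is_inf, alg_le; split; [| split].
  - rewrite (proj1 (meet_join_comm HA _ x)), (proj1 (meet_join_assoc HA _ _ _)).
    rewrite (proj1 (meet_join_idem HA x)); reflexivity.
  - rewrite <- (proj1 (meet_join_assoc HA _ _ _)), (proj1 (meet_join_idem HA y)); reflexivity.
  - intros w Hx Hy; rewrite (proj1 (meet_join_assoc HA _ _ _)), Hx, Hy; reflexivity.
Qed.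

Lemma alg_is_sup x y : is_sup (alg_le A) x y (x ⊔ y).
Proof.
  unfold is_sup; rewrite !alg_le_join; split; [| split].
  - rewrite (proj2 (meet_join_assoc HA _ _ _)), (proj2 (meet_join_idem HA x)); reflexivity.
  - rewrite (proj2 (meet_join_comm HA x y)), (proj2 (meet_join_assoc HA _ _ _)).
    rewrite (proj2 (meet_join_idem HA y)); reflexivity.
  - intros w; rewrite !alg_le_join; intros Hx Hy.
    rewrite <- (proj2 (meet_join_assoc HA _ _ _)), Hy, Hx; reflexivity.
Qed.

Definition alg_monoid_mixin : AbelianMonoid.mixin_of A.
Proof.
  refine (AbelianMonoid.Mixin A (@as_add A) 𝟎 _ _ _).
  - exact (add_comm HA).
  - intros x y z; symmetry; apply (add_assoc HA).
  - exact (add_zero HA).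
Defined.

Definition alg_group_class : AbelianGroup.class_of A :=
  AbelianGroup.Class A alg_monoid_mixin
    (AbelianGroup.Mixin (AbelianMonoid.Pack A alg_monoid_mixin A)
       (@as_opp A) (add_opp HA)).

Definition alg_module_class : ModuleSpace.class_of R_Ring A.
Proof.
  refine (ModuleSpace.Class R_Ring A alg_group_class
    (ModuleSpace.Mixin R_Ring (AbelianGroup.Pack A alg_group_class A)
       (@as_scal A) _ _ _ _)).
  - intros l u x; symmetry; apply (scal_Rmult HA).
  - exact (scal_R1 HA).
  - exact (scal_add HA).
  - exact (scal_Rplus HA).
Defined.

Definition alg_module : ModuleSpace R_Ring :=
  ModuleSpace.Pack R_Ring A alg_module_class A.

Definition alg_ring_mixin : Ring.mixin_of alg_module.
Proof.
  refine (Ring.Mixin alg_module (@as_mul A) 𝟏 _ _ _ _ _).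
  - intros x y z; symmetry; apply (mul_assoc HA).
  - intros x; apply (mul_one HA).
  - intros x; rewrite (proj1 (mul_one HA x)); apply (mul_one HA).
  - exact (mul_add_l HA).
  - exact (mul_add_r HA).
Defined.

Lemma alg_is_vector_lattice : @is_vector_lattice alg_module (alg_le A).
Proof.
  split.
  - exact alg_le_order.
  - intros x y z Hxy; unfold alg_le in *.
    change ((x ⊕ z) ⊓ (y ⊕ z) = x ⊕ z).
    rewrite (add_comm HA x), (add_comm HA y), <- (add_meet HA), Hxy; reflexivity.
  - intros l x Hl Hx; unfold alg_le in *.
    pose proof (scal_meet HA x Hl) as Hm.
    change (𝟎 ⊓ x = 𝟎) in Hx; change (𝟎 ⊓ (m[l] x) = 𝟎).
    rewrite <- Hm, Hx; exact (scal_zero_r (V := alg_module) l).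
  - intros x y; exists (x ⊓ y); apply alg_is_inf.
  - intros x y; exists (x ⊔ y); apply alg_is_sup.
Qed.

(** For [x, y >= 0] the factors in [mul_pos] are [⊖x] and [⊖y], and their product is
    [x ⊙ y]. *)
Lemma alg_is_uvla : @is_unital_vector_lattice_algebra alg_module alg_ring_mixin (alg_le A).
Proof.
  pose proof alg_is_vector_lattice as HV.
  pose (mul := @as_mul A : alg_module -> alg_module -> alg_module).
  assert (Hl : forall a x y, scal a (mul x y) = mul (scal a x) y)
    by (intros a x y; apply (scal_mul HA)).
  assert (Hr : forall a x y, scal a (mul x y) = mul x (scal a y))
    by (intros a x y; destruct (scal_mul HA a x y); etransitivity; eassumption).
  split; [exact HV | exact Hl | exact Hr |].
  intros x y Hx Hy.
  assert (Hinf : forall z, alg_le A 𝟎 z -> z ⊓ (⊖ z) = ⊖ z).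
  { intros z Hz; rewrite (proj1 (meet_join_comm HA _ _)).
    apply (ord_trans _ _ alg_le_order) with 𝟎; auto.
    exact (vl_opp_le_zero _ _ HV z Hz). }
  pose proof (mul_pos HA x y) as Hp.
  rewrite (Hinf x Hx), (Hinf y Hy) in Hp.
  rewrite (bilinear_opp_opp alg_module mul Hl Hr x y : (⊖ x) ⊙ (⊖ y) = x ⊙ y) in Hp.
  exact Hp.
Qed.

End AbstractAlgebra.

Definition uvla_of_alg (A : AbsAlg) : UVLA :=
  MkUVLA (alg_is_uvla A (aa_identities A)).

Lemma uvla_inf_of_alg (A : AbsAlg) (x y : A) : @uvla_inf (uvla_of_alg A) x y = x ⊓ y.
Proof. apply uvla_inf_eq, (alg_is_inf A (aa_identities A)). Qed.

Lemma uvla_sup_of_alg (A : AbsAlg) (x y : A) : @uvla_sup (uvla_of_alg A) x y = x ⊔ y.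
Proof. apply uvla_sup_eq, (alg_is_sup A (aa_identities A)). Qed.

(** * The two constructions are mutually inverse *)

Lemma AbsAlg_eq (A B : AbsAlg) : aa_sig A = aa_sig B -> A = B.
Proof.
  destruct A as [A HA], B as [B HB]; simpl; intros <-.
  f_equal; apply proof_irrelevance.
Qed.

(** The structures are nested records whose proof fields occur in the types of
    later fields. With a common carrier the operations can be identified first,
    and then the proofs, in the order of dependency. *)
Lemma UVLA_eq (T : Type) (c c' : ModuleSpace.class_of R_Ring T)
    (M := ModuleSpace.Pack R_Ring T c T) (M' := ModuleSpace.Pack R_Ring T c' T)
    (r : Ring.mixin_of M) (r' : Ring.mixin_of M') (le le' : relation T)
    (H : @is_unital_vector_lattice_algebra M r le)
    (H' : @is_unital_vector_lattice_algebra M' r' le') :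
  @plus M = @plus M' -> @zero M = @zero M' -> @opp M = @opp M' ->
  @scal R_Ring M = @scal R_Ring M' ->
  Ring.mult _ r = Ring.mult _ r' -> Ring.one _ r = Ring.one _ r' -> le = le' ->
  MkUVLA H = MkUVLA H'.
Proof.
  subst M M'.
  destruct c as [[[p z p1 p2 p3] [o o1]] [s s1 s2 s3 s4]].
  destruct c' as [[[p' z' p1' p2' p3'] [o' o1']] [s' s1' s2' s3' s4']].
  destruct r as [m e m1 m2 m3 m4 m5], r' as [m' e' m1' m2' m3' m4' m5'].
  cbv [plus zero opp scal] in *; simpl in *.
  intros; subst p' z' o' s' m' e' le'.
  destruct (proof_irrelevance _ p1 p1'), (proof_irrelevance _ p2 p2'),
    (proof_irrelevance _ p3 p3').
  destruct (proof_irrelevance _ o1 o1').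
  destruct (proof_irrelevance _ s1 s1'), (proof_irrelevance _ s2 s2'),
    (proof_irrelevance _ s3 s3'), (proof_irrelevance _ s4 s4').
  destruct (proof_irrelevance _ m1 m1'), (proof_irrelevance _ m2 m2'),
    (proof_irrelevance _ m3 m3'), (proof_irrelevance _ m4 m4'),
    (proof_irrelevance _ m5 m5').
  f_equal; apply proof_irrelevance.
Qed.

(** Only the order is rebuilt, from the infimum that it determines. *)
Lemma uvla_of_alg_of_uvla (A : UVLA) : uvla_of_alg (alg_of_uvla A) = A.
Proof.
  assert (Hle : alg_le (alg_of_uvla A) = @uvla_le A).
  { apply functional_extensionality; intros x.
    apply functional_extensionality; intros y.
    apply propositional_extensionality; symmetry.
    apply (le_meetP _ _ (uvla_order A) _ (uvla_inf_spec A)). }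
  destruct A as [T c r le H].
  apply UVLA_eq; try reflexivity; exact Hle.
Qed.

(** Only [⊓] and [⊔] are rebuilt, as the infimum and supremum that they are. *)
Lemma alg_of_uvla_of_alg (A : AbsAlg) : alg_of_uvla (uvla_of_alg A) = A.
Proof.
  apply AbsAlg_eq; destruct A as [A HA].
  assert (Hinf : uvla_inf (uvla_of_alg (MkAbsAlg HA)) = @as_meet A).
  { apply functional_extensionality; intros x.
    apply functional_extensionality; intros y.
    apply (uvla_inf_of_alg (MkAbsAlg HA)). }
  assert (Hsup : uvla_sup (uvla_of_alg (MkAbsAlg HA)) = @as_join A).
  { apply functional_extensionality; intros x.
    apply functional_extensionality; intros y.
    apply (uvla_sup_of_alg (MkAbsAlg HA)). }
  cbn [aa_sig alg_of_uvla]; unfold alg_sig_of_uvla; rewrite Hinf, Hsup.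
  destruct A; reflexivity.
Qed.

(** * Morphisms and the isomorphism of categories *)

Lemma alg_hom_of_uvla_hom (A B : UVLA) (h : uvla_module A -> uvla_module B) :
  is_uvla_hom h -> @is_alg_hom (alg_of_uvla A) (alg_of_uvla B) h.
Proof.
  intros [Hp Hs Hi Hj Hm H1]; split; simpl; auto.
  - rewrite <- (scal_zero_l (V := uvla_module A) zero), Hs.
    apply (scal_zero_l (V := uvla_module B)).
  - intros x; rewrite <- !scal_opp_one; apply Hs.
  - intros x y; symmetry; apply uvla_inf_eq, Hi, uvla_inf_spec.
  - intros x y; symmetry; apply uvla_sup_eq, Hj, uvla_sup_spec.
Qed.

Lemma uvla_hom_of_alg_hom (A B : AbsAlg) (h : A -> B) :
  is_alg_hom h -> @is_uvla_hom (uvla_of_alg A) (uvla_of_alg B) h.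
Proof.
  intros [H0 H1 Ha Ho Hs Hm Hi Hj]; split; auto.
  - intros x y z Hz.
    rewrite <- (uvla_inf_eq _ _ _ _ Hz).
    rewrite (uvla_inf_of_alg A), Hi.
    apply (alg_is_inf B (aa_identities B)).
  - intros x y z Hz.
    rewrite <- (uvla_sup_eq _ _ _ _ Hz).
    rewrite (uvla_sup_of_alg A), Hj.
    apply (alg_is_sup B (aa_identities B)).
Qed.

Definition alg_functor : Functor UVLA_cat AbsAlg_cat :=
  @MkFunctor UVLA_cat AbsAlg_cat alg_of_uvla
    (fun A B h => exist _ (proj1_sig h) (alg_hom_of_uvla_hom A B _ (proj2_sig h)))
    (fun A => subset_eq_compat _ _ _ _ _ _ eq_refl)
    (fun A B C f g => subset_eq_compat _ _ _ _ _ _ eq_refl).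

Definition uvla_functor : Functor AbsAlg_cat UVLA_cat :=
  @MkFunctor AbsAlg_cat UVLA_cat uvla_of_alg
    (fun A B h => exist _ (proj1_sig h) (uvla_hom_of_alg_hom A B _ (proj2_sig h)))
    (fun A => subset_eq_compat _ _ _ _ _ _ eq_refl)
    (fun A B C f g => subset_eq_compat _ _ _ _ _ _ eq_refl).

Theorem proposition4p5 :
  exists F : Functor UVLA_cat AbsAlg_cat,
    is_isomorphism F /\ functor_comp AbsAlg_forget F = UVLA_forget.
Proof.
  exists alg_functor; split; [exists uvla_functor; split |].
  (* After forgetting, the maps on objects and morphisms agree by computation,
     and only the proofs of functoriality differ. *)
  - apply concrete_functor_eq; [exact uvla_of_alg_of_uvla | apply functor_eq].
  - apply concrete_functor_eq; [exact alg_of_uvla_of_alg | apply functor_eq].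
  - apply functor_eq.
Qed.
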